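(* Let $A\in\mathcal D_n$, let $H_n=I_n-\frac1n\mathbf1\mathbf1^T$, and define $$\Delta=\operatorname{diag}\bigl(\|(AH_n)_{1,:}\|,\ldots,\|(AH_n)_{n,:}\|\bigr).$$ Then $\Delta$ is invertible and $$C(A)=\Delta^{-1}AH_nA^T\Delta^{-1}.$$ In particular, $\operatorname{rank}C(A)=\operatorname{rank}(AH_n)$. Consequently, $$\operatorname{rank}A-1\le\operatorname{rank}C(A)\le\min\{\operatorname{rank}A,\,n-1\}.$$ Every fixed point of $C$ is therefore singular and lies on the relative boundary of $\mathcal C_n$.
   Context: $\mathcal D_n$ is the set of real $n\times n$ matrices all of whose rows are nonconstant. For nonconstant $x,y\in\mathbb R^n$, with means $\bar x,\bar y$, the Pearson correlation is $\operatorname{corr}(x,y)=\frac{\sum_k(x_k-\bar x)(y_k-\bar y)}{\sqrt{\sum_k(x_k-\bar x)^2\sum_k(y_k-\bar y)^2}}$. For $A\in\mathcal D_n$ with rows $r_1,\dots,r_n$, $C(A)$ is the $n\times n$ matrix with $[C(A)]_{ij}=\operatorname{corr}(r_i,r_j)$; a fixed point of $C$ is $A\in\mathcal D_n$ with $C(A)=A$. $\mathbf1\in\mathbb R^n$ is the all-ones column vector, $M_{i,:}$ denotes the $i$-th row of $M$, and $\|\cdot\|$ is the Euclidean norm. $\mathcal C_n$ is the set of real symmetric positive semidefinite $n\times n$ matrices with unit diagonal (every fixed point of $C$ belongs to $\mathcal C_n$); its relative boundary is taken in the affine space of symmetric $n\times n$ matrices with unit diagonal. *)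

(* Defs.v *)
From mathcomp Require Import all_boot all_order all_algebra.
From mathcomp Require Import all_classical all_reals all_analysis.
Set Implicit Arguments.
Unset Strict Implicit.
Unset Printing Implicit Defensive.
Import Order.TTheory GRing.Theory Num.Theory.
Import numFieldNormedType.Exports.
Local Open Scope classical_set_scope.
Local Open Scope ring_scope.

Section Correlation.
Context {R : realType} {n : nat}.

Definition nonconstant (x : 'rV[R]_n) : Prop := ~ exists c : R, x = const_mx c.

Definition mean (x : 'rV[R]_n) : R := (\sum_k x 0 k) / n%:R.

(* Total: takes the junk value 0 when x or y is constant. *)
Definition corr (x y : 'rV[R]_n) : R :=
  (\sum_k (x 0 k - mean x) * (y 0 k - mean y)) /
  Num.sqrt ((\sum_k (x 0 k - mean x) ^+ 2) * (\sum_k (y 0 k - mean y) ^+ 2)).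

Definition nonconstant_rows : set 'M[R]_n :=
  [set A | forall i, nonconstant (row i A)].

Definition corr_mx (A : 'M[R]_n) : 'M[R]_n :=
  \matrix_(i, j) corr (row i A) (row j A).

Definition corr_fixed_point (A : 'M[R]_n) : Prop :=
  nonconstant_rows A /\ corr_mx A = A.

(* The library norm on matrices is the sup norm, hence this definition. *)
Definition euclidean_norm (x : 'rV[R]_n) : R := Num.sqrt (\sum_k x 0 k ^+ 2).

Definition ones : 'cV[R]_n := const_mx 1.

Definition centering_mx : 'M[R]_n := 1%:M - n%:R^-1 *: (ones *m ones^T).

Definition row_norms_mx (M : 'M[R]_n) : 'M[R]_n :=
  diag_mx (\row_i euclidean_norm (row i M)).

Definition psdmx (A : 'M[R]_n) : Prop :=
  forall x : 'cV[R]_n, 0 <= (x^T *m A *m x) 0 0.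

Definition sym_unit_diag : set 'M[R]_n :=
  [set A | A^T = A /\ forall i, A i i = 1].

Definition elliptope : set 'M[R]_n := [set A | sym_unit_diag A /\ psdmx A].

End Correlation.

Arguments ones R n : clear implicits.
Arguments centering_mx R n : clear implicits.
Arguments sym_unit_diag R n : clear implicits.
Arguments elliptope R n : clear implicits.

(* Boundary of S in the subspace topology of L.  In [subspace L] the points
   outside L are isolated, so the result is always included in L. *)
Definition relative_boundary {T : topologicalType} (L S : set T) : set T :=
  @closure (subspace L) S `\` @interior (subspace L) S.

(* Main.v *)
Require Import Defs.
From mathcomp Require Import all_boot all_order all_algebra.
From mathcomp Require Import all_classical all_reals all_analysis.
Set Implicit Arguments.
Unset Strict Implicit.
Unset Printing Implicit Defensive.
Import Order.TTheory GRing.Theory Num.Theory.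
Import numFieldNormedType.Exports.
Local Open Scope classical_set_scope.
Local Open Scope ring_scope.

(** The centering matrix H replaces every row of A by its deviation from the
    mean, so the entries of (AH)(AH)^T are the inner products of centered rows
    and Delta holds their norms; a nonconstant row has a nonzero centered row,
    so Delta is invertible, and dividing by the norms gives
    C(A) = Delta^-1 (AH)(AH)^T Delta^-1 = Delta^-1 A H A^T Delta^-1, because H
    is symmetric and idempotent ([corr_mxE], [gram_centering]).

    Over an ordered field a Gram matrix N N^T has the rank of N ([rank_gram]),
    whence rank C(A) = rank (AH).  Since A - AH is a multiple of A 1 1^T, which
    has rank at most one, centering lowers the rank by at most one; since H
    kills 1, it leaves a rank below n.

    A fixed point A = C(A) is therefore singular, and it is a Gram matrix with
    unit diagonal, so it is in the elliptope.  It is not interior there: if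
    v A = 0 with v nonzero, then the matrices (1 + t) A - t I, t > 0, still are
    symmetric with unit diagonal and tend to A, but their quadratic form takes
    the value - t |v|^2 < 0 at v ([singular_relative_boundary]). *)

(** * Gram matrices *)

Lemma row_sqr_norm (R : pzRingType) n (x : 'rV[R]_n) :
  (x *m x^T) 0 0 = \sum_k x 0 k ^+ 2.
Proof. by rewrite mxE; apply: eq_bigr => k _; rewrite mxE expr2. Qed.

Lemma row_sqr_norm_ge0 (R : realDomainType) n (x : 'rV[R]_n) :
  0 <= (x *m x^T) 0 0.
Proof. by rewrite row_sqr_norm; apply: sumr_ge0 => k _; apply: sqr_ge0. Qed.

(** The diagonal of [N *m N^T] lists the sums of squares of the rows of N. *)
Lemma gram_eq0 (R : realDomainType) m n (N : 'M[R]_(m, n)) :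
  N *m N^T = 0 -> N = 0.
Proof.
move=> NN0; apply/matrixP => i j; rewrite [RHS]mxE.
have /eqP := congr1 (fun M : 'M[R]_m => M i i) NN0; rewrite !mxE => /eqP s0.
have N2_0 : N i j * N^T j i = 0.
  by apply: (psumr_eq0P _ s0) => // k _; rewrite mxE -expr2 sqr_ge0.
by move: N2_0; rewrite mxE -expr2 => /eqP; rewrite sqrf_eq0 => /eqP.
Qed.

(** If K annihilates [M *m M^T] on the left, then [K *m M] has zero Gram
    matrix; so the two matrices have the same left kernel. *)
Lemma rank_gram (R : realFieldType) m n (M : 'M[R]_(m, n)) :
  \rank (M *m M^T) = \rank M.
Proof.
apply/eqP; rewrite eqn_leq mxrankM_maxl /=.
set K := kermx (M *m M^T).
have KM0 : K *m M = 0.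
  by apply: gram_eq0; rewrite trmx_mul mulmxA -(mulmxA K) mulmx_ker mul0mx.
have /mxrankS : (K <= kermx M)%MS by apply/sub_kermxP.
by rewrite !mxrank_ker leq_subLR addnC -leq_subLR subKn ?rank_leq_row.
Qed.

Lemma psdmx_gram (R : realType) n (N : 'M[R]_n) : psdmx (N *m N^T).
Proof.
move=> x; set y := x^T *m N.
have -> : x^T *m (N *m N^T) *m x = y *m y^T.
  by rewrite /y trmx_mul trmxK !mulmxA.
exact: row_sqr_norm_ge0.
Qed.

(** * Centering *)

Section Centering.
Variables (R : realType) (n : nat) (n_gt0 : (0 < n)%N).
Local Notation H := (centering_mx R n).
Local Notation e := (ones R n).

Lemma mulmx_centeringE m (A : 'M[R]_(m, n)) i k :
  (A *m H) i k = A i k - mean (row i A).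
Proof.
rewrite mulmxBr mulmx1 -scalemxAr !mxE /mean mulrC; congr (_ - _ * _).
by apply: eq_bigr => j _; rewrite !mxE big_ord1 !mxE !mulr1.
Qed.

Lemma centering_sym : H^T = H.
Proof. by rewrite /centering_mx linearB linearZ /= trmx_mul trmxK trmx1. Qed.

Lemma centering_ones : H *m e = 0.
Proof.
have ee : e^T *m e = n%:R%:M.
  apply/matrixP => i j; rewrite !mxE (eq_bigr (fun=> 1)) => [|k _].
    by rewrite sumr_const card_ord !ord1.
  by rewrite !mxE mulr1.
rewrite mulmxBl mul1mx -scalemxAl -mulmxA ee mul_mx_scalar scalerA.
by rewrite mulVf ?scale1r ?subrr // pnatr_eq0 -lt0n.
Qed.

Lemma centering_idem : H *m H = H.
Proof.
rewrite [X in _ *m X]/centering_mx mulmxBr mulmx1 -scalemxAr mulmxA.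
by rewrite centering_ones mul0mx scaler0 subr0.
Qed.

Lemma gram_centering m (A : 'M[R]_(m, n)) :
  (A *m H) *m (A *m H)^T = A *m H *m A^T.
Proof.
by rewrite trmx_mul centering_sym mulmxA -(mulmxA A H H) centering_idem.
Qed.

(** Centering subtracts from A a matrix of rank at most one, and its result
    annihilates the vector [ones]. *)
Lemma rank_mulmx_centering m (A : 'M[R]_(m, n)) :
  (\rank A - 1 <= \rank (A *m H) <= minn (\rank A) (n - 1))%N.
Proof.
apply/andP; split.
  (* A = AH + n^-1 A 1 1^T, and the second term factors through one column. *)
  have {1}-> : A = A *m H + (n%:R^-1 *: (A *m e)) *m e^T.
    by rewrite mulmxBr mulmx1 -scalemxAr -scalemxAl mulmxA subrK.
  rewrite leq_subLR addnC (leq_trans (mxrank_add _ _)) // leq_add2l.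
  by rewrite (leq_trans (mxrankM_maxl _ _)) ?rank_leq_col.
rewrite leq_min mxrankM_maxl /=.
have /mulmx0_rank_max : A *m H *m e = 0.
  by rewrite -mulmxA centering_ones mulmx0.
have -> : \rank e = 1%N.
  rewrite -mxrank_tr rank_rV; case: eqP => // /matrixP/(_ 0 (Ordinal n_gt0)).
  by rewrite !mxE => /eqP; rewrite oner_eq0.
by rewrite leq_subRL // addnC.
Qed.

End Centering.

(** * Correlation matrices *)

Section CorrelationMatrix.
Variables (R : realType) (n : nat).
Local Notation H := (centering_mx R n).

Section Rows.
Variable A : 'M[R]_n.
Hypothesis nconstA : nonconstant_rows A.
Local Notation M := (A *m H).
Local Notation Delta := (row_norms_mx M).
Local Notation d i := (euclidean_norm (row i M)).

Lemma centered_sqr_sum i :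
  \sum_k (row i A 0 k - mean (row i A)) ^+ 2 = \sum_k row i M 0 k ^+ 2.
Proof. by apply: eq_bigr => k _; rewrite !mxE -mulmx_centeringE mxE. Qed.

(** If the centered norm vanishes, then all entries of the row equal its mean,
    against nonconstancy. *)
Lemma centered_row_norm_neq0 i : d i != 0.
Proof.
have s_ge0 : 0 <= \sum_k row i M 0 k ^+ 2.
  by apply: sumr_ge0 => k _; apply: sqr_ge0.
rewrite sqrtr_eq0 -ltNge lt_neqAle s_ge0 andbT eq_sym; apply/eqP => s0.
apply: (@nconstA i); exists (mean (row i A)); apply/matrixP => u k.
have := psumr_eq0P (fun k _ => sqr_ge0 (row i M 0 k)) s0 (i := k) isT.
move/eqP; rewrite sqrf_eq0 mxE mulmx_centeringE subr_eq0 => /eqP <-.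
by rewrite !mxE.
Qed.

Lemma row_norms_unit : Delta \in unitmx.
Proof.
rewrite unitmxE det_diag unitfE; apply/prodf_neq0 => i _; rewrite mxE.
exact: centered_row_norm_neq0.
Qed.

(** Multiplying by the norms undoes the normalization in [corr]; this is the
    factorization of the correlation matrix before any inverse is taken. *)
Lemma scaled_corr_mx : Delta *m corr_mx A *m Delta = M *m M^T.
Proof.
rewrite mul_mx_diag mul_diag_mx; apply/matrixP => i j.
rewrite [LHS]mxE [X in X * _]mxE ![(\row_k _) 0 _]mxE.
rewrite [corr_mx A i j]mxE [RHS]mxE /corr.
rewrite !centered_sqr_sum sqrtrM; last first.
  by apply: sumr_ge0 => k _; apply: sqr_ge0.
rewrite -[Num.sqrt _ * _]/(d i * d j) mulrAC mulrC divfK.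
  apply: eq_bigr => k _.
  by rewrite [M^T k j]mxE !mulmx_centeringE ![row _ A 0 k]mxE.
by rewrite mulf_neq0 ?centered_row_norm_neq0.
Qed.

Lemma corr_mxE :
  corr_mx A = invmx Delta *m (M *m M^T) *m invmx Delta.
Proof.
by rewrite -scaled_corr_mx -!mulmxA mulmxV ?mulmx1 ?mulKmx ?row_norms_unit.
Qed.

(** The form that yields both positive semidefiniteness and the rank: the rows
    of [invmx Delta *m M] are the standardized rows of A. *)
Lemma corr_mx_gram :
  corr_mx A = (invmx Delta *m M) *m (invmx Delta *m M)^T.
Proof.
by rewrite corr_mxE [(invmx _ *m _)^T]trmx_mul trmx_inv tr_diag_mx !mulmxA.
Qed.

Lemma rank_corr_mx : \rank (corr_mx A) = \rank M.
Proof.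
rewrite corr_mx_gram rank_gram eqmxMfull //.
by rewrite row_full_unit unitmx_inv row_norms_unit.
Qed.

Lemma corr_mx_elliptope : elliptope R n (corr_mx A).
Proof.
split; last by rewrite corr_mx_gram; apply: psdmx_gram.
split=> [|i]; first by rewrite corr_mx_gram trmx_mul trmxK.
rewrite mxE /corr -expr2 sqrtr_sqr ger0_norm; last first.
  by apply: sumr_ge0 => k _; apply: sqr_ge0.
rewrite (eq_bigr (fun k => (row i A 0 k - mean (row i A)) ^+ 2)) //.
rewrite mulfV // centered_sqr_sum.
apply: contra_neq (centered_row_norm_neq0 i) => s0.
by rewrite /euclidean_norm s0 sqrtr0.
Qed.

End Rows.

(** * The boundary of the elliptope *)

(** Moving from A away from the identity keeps the symmetry and the unit
    diagonal, and makes the quadratic form negative on the kernel of A. *)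
Lemma singular_relative_boundary (A : 'M[R]_n) :
  elliptope R n A -> A \notin unitmx ->
  relative_boundary (sym_unit_diag R n) (elliptope R n) A.
Proof.
move=> ellA singA; have [[symA diagA] _] := ellA.
split; first exact: subset_closure.
rewrite /interior /= => intA.
have [V nV VE] := (nbhs_subspace_ex _ (conj symA diagA)).1 intA.
have [r /= r_gt0 rV] := (nbhs_ballP _ _).1 nV.
(* t is chosen so that t |A i j - I i j| < r for all i and j. *)
pose b := \sum_i \sum_j `|(A - 1%:M) i j|.
have b_ge0 : 0 <= b by do 2!apply: sumr_ge0 => ? _.
have b1_gt0 : 0 < b + 1 by rewrite ltr_wpDl.
pose t := r / (b + 1).
have t_gt0 : 0 < t by rewrite divr_gt0.
pose B := A + t *: (A - 1%:M).
have BL : sym_unit_diag R n B.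
  split; first by rewrite /B linearD linearZ linearB /= symA trmx1.
  by move=> i; rewrite !mxE diagA eqxx subrr mulr0 addr0.
have VB : V B.
  apply: rV; split=> // i j; rewrite /ball /= /B.
  rewrite [in X in _ - X]mxE opprD addNKr.
  rewrite normrN mxE normrM gtr0_norm // /t mulrAC ltr_pdivrMr // ltr_pM2l //.
  rewrite ltr_pwDr // /b (bigD1 i) //= (bigD1 j) //= -addrA lerDl.
  by rewrite addr_ge0 ?sumr_ge0 // => k _; rewrite sumr_ge0.
have [[_ psdB] _] : (elliptope R n `&` sym_unit_diag R n) B by rewrite VE.
(* On a vector v with v A = 0, the form of B is - t |v|^2. *)
move: singA; rewrite -row_free_unit -kermx_eq0.
move=> /rowV0Pn[v /sub_kermxP vA v_neq0].
have := psdB v^T; rewrite trmxK /B mulmxDr vA add0r -scalemxAr mulmxBr vA.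
rewrite mulmx1 sub0r -scalemxAl mulNmx !mxE pmulr_rge0 // oppr_ge0 => vv_le0.
have vv0 : (v *m v^T) 0 0 = 0.
  by apply/eqP; rewrite eq_le row_sqr_norm_ge0 andbT mxE.
case/eqP: v_neq0; apply: gram_eq0; apply/matrixP => i j.
by rewrite !ord1 vv0 mxE.
Qed.

End CorrelationMatrix.

Theorem proposition2 (R : realType) (n : nat) (n_gt0 : (0 < n)%N) :
  (forall A : 'M[R]_n, nonconstant_rows A ->
     let H := centering_mx R n in
     let Delta := row_norms_mx (A *m H) in
     [/\ Delta \in unitmx,
         corr_mx A = invmx Delta *m A *m H *m A^T *m invmx Delta,
         \rank (corr_mx A) = \rank (A *m H)
       & (\rank A - 1 <= \rank (corr_mx A) <= minn (\rank A) (n - 1))%N]) /\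
  (forall A : 'M[R]_n, corr_fixed_point A ->
     A \notin unitmx /\
     relative_boundary (sym_unit_diag R n) (elliptope R n) A).
Proof.
split=> [A nconstA H Delta|A [nconstA fixA]].
  split; [exact: row_norms_unit| |exact: rank_corr_mx|].
    by rewrite corr_mxE // gram_centering // !mulmxA.
  by rewrite rank_corr_mx // rank_mulmx_centering.
have singA : A \notin unitmx.
  rewrite -row_full_unit /row_full -fixA rank_corr_mx // neq_ltn.
  have /andP[_] := rank_mulmx_centering n_gt0 A.
  by rewrite leq_min subn1 => /andP[_ /leq_ltn_trans ->] //; rewrite prednK.
split=> //; apply: singular_relative_boundary => //.
by rewrite -fixA; apply: corr_mx_elliptope.
Qed.
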